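(* Let $X$ be a Hausdorff sequentially complete locally convex space over $\mathbb{C}$, let $\mathcal{A}$ be a multivalued linear operator in $X$, and let $C\in L(X)$ (not necessarily injective) satisfy $C\mathcal{A}\subseteq \mathcal{A}C$. (i) Let $x\in X$, $k\in\mathbb{N}_0$ and $\lambda,z\in\rho_C(\mathcal{A})$ with $z\neq\lambda$. Then $$(z-\mathcal{A})^{-1}C\bigl((\lambda-\mathcal{A})^{-1}C\bigr)^{k}x=\frac{(-1)^{k}}{(z-\lambda)^{k}}(z-\mathcal{A})^{-1}C^{k+1}x+\sum_{i=1}^{k}\frac{(-1)^{k-i}\bigl((\lambda-\mathcal{A})^{-1}C\bigr)^{i}C^{k+1-i}x}{(z-\lambda)^{k+1-i}}.$$ (ii) Let $k\in\mathbb{N}_0$, $x,y\in X$, $\lambda_0,z\in\rho_C(\mathcal{A})$ with $z\neq\lambda_0$, and $y\in(\lambda_0-\mathcal{A})^{k}x$. Then $$(z-\mathcal{A})^{-1}C^{k+1}x=\frac{(-1)^{k}}{(z-\lambda_0)^{k}}(z-\mathcal{A})^{-1}C^{k+1}y+\sum_{i=1}^{k}\frac{(-1)^{k-i}\bigl((\lambda_0-\mathcal{A})^{-1}C\bigr)^{i}C^{k+1-i}y}{(z-\lambda_0)^{k+1-i}}.$$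
   Context: $L(X)$ is the space of continuous linear operators on $X$. A multivalued linear operator (MLO) in $X$ is a map $\mathcal{A}:X\to P(X)$ (power set) such that $D(\mathcal{A})=\{x:\mathcal{A}x\neq\emptyset\}$ is a linear subspace, $\mathcal{A}x+\mathcal{A}y\subseteq\mathcal{A}(x+y)$ for $x,y\in D(\mathcal{A})$, and $\lambda\mathcal{A}x\subseteq\mathcal{A}(\lambda x)$ for $\lambda\in\mathbb{C}$, $x\in D(\mathcal{A})$; equivalently, its graph $\{(x,y):y\in\mathcal{A}x\}$ is a linear subspace of $X\times X$, and $\mathcal{A}$ is identified with its graph. $R(\mathcal{A})=\bigcup_{x\in D(\mathcal{A})}\mathcal{A}x$; $\mathcal{A}^{-1}$ is the inverse relation; the product is composition of relations: $D(\mathcal{B}\mathcal{A})=\{x\in D(\mathcal{A}):D(\mathcal{B})\cap\mathcal{A}x\neq\emptyset\}$, $\mathcal{B}\mathcal{A}x=\mathcal{B}(D(\mathcal{B})\cap\mathcal{A}x)$. Powers: $\mathcal{A}^0=I$, $\mathcal{A}^{n}=\mathcal{A}\mathcal{A}^{n-1}$. $\lambda-\mathcal{A}$ means $\lambda I-\mathcal{A}$, with $D(\lambda-\mathcal{A})=D(\mathcal{A})$ and $(\lambda-\mathcal{A})x=\lambda x-\mathcal{A}x$. The condition $C\mathcal{A}\subseteq\mathcal{A}C$ means: $(x,y)\in\mathcal{A}$ implies $(Cx,Cy)\in\mathcal{A}$. The $C$-resolvent set $\rho_C(\mathcal{A})$ is the set of $\lambda\in\mathbb{C}$ such that $R(C)\subseteq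 R(\lambda-\mathcal{A})$ and $(\lambda-\mathcal{A})^{-1}C$ is a single-valued continuous linear operator on $X$. $(\lambda-\mathcal{A})^{-1}C^{j}$ denotes $((\lambda-\mathcal{A})^{-1}C)C^{j-1}$, $j\ge 1$. Empty sums are $0$. *)

(* Defs.v *)
From HB Require Import structures.
From mathcomp Require Import all_boot all_order all_algebra.
From mathcomp Require Export complex.
From mathcomp Require Import all_classical all_reals all_analysis.

Set Implicit Arguments.
Unset Strict Implicit.
Unset Printing Implicit Defensive.

Import Order.TTheory GRing.Theory Num.Theory.
Import numFieldNormedType.Exports.

Local Open Scope classical_set_scope.
Local Open Scope ring_scope.

(* Cauchy sequences are those of the topological vector space, expressed with
   neighborhoods of 0: the structure tvsType only requires its uniformity to
   induce the topology, not to be translation-invariant, so the library's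
   [cauchy] could denote something else. *)
Definition tvs_cauchy_seq (K : numDomainType) (X : tvsType K) (u : nat -> X) :=
  forall U : set X, nbhs 0 U -> \forall m & n \near \oo, U (u m - u n).

Definition sequentially_complete (K : numDomainType) (X : tvsType K) :=
  forall u : nat -> X, tvs_cauchy_seq u -> exists l : X, u @ \oo --> l.

Section Relations.
Context {X : Type}.
Implicit Types A B : X -> set X.

Definition mdom A : set X := [set x | A x !=set0].
Definition mran A : set X := \bigcup_(x in mdom A) A x.
Definition minv A : X -> set X := fun y => [set x | A x y].

(* the product BA, i.e. A is applied first *)
Definition mcomp B A : X -> set X :=
  fun x => \bigcup_(y in mdom B `&` A x) B y.

(* a single-valued everywhere defined map, seen as a multivalued one *)
Definition mgraph (f : X -> X) : X -> set X := fun x => [set f x].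

Fixpoint mpow A (n : nat) : X -> set X :=
  if n is n'.+1 then mcomp A (mpow A n') else mgraph id.

End Relations.

Section MultivaluedLinear.
Context {K : numFieldType} {X : tvsType K}.
Implicit Types (A : X -> set X) (C : X -> X) (l : K).

Record is_mlo A : Prop := IsMLO {
  mlo_dom0 : mdom A 0 ;
  mlo_domD : forall x y, mdom A x -> mdom A y -> mdom A (x + y) ;
  mlo_domZ : forall l x, mdom A x -> mdom A (l *: x) ;
  mlo_add : forall x y, mdom A x -> mdom A y ->
    [set u + v | u in A x & v in A y] `<=` A (x + y) ;
  mlo_scale : forall l x, mdom A x ->
    [set l *: u | u in A x] `<=` A (l *: x) }.

(* the multivalued operator l - A *)
Definition mshift l A : X -> set X := fun x => [set l *: x - y | y in A x].

(* the multivalued operator (l - A)^-1 C *)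
Definition mresolvent A C l : X -> set X :=
  mcomp (minv (mshift l A)) (mgraph C).

Definition rhoC A C : set K := [set l |
  range C `<=` mran (mshift l A) /\
  exists T : {linear X -> X},
    continuous T /\ mresolvent A C l = mgraph T].

(* (l - A)^-1 C as an operator; its value is meaningful only for l in
   [rhoC A C], see [mresolventE] *)
Definition cresolvent A C l : X -> X := fun x => xget 0 (mresolvent A C l x).

(* (l - A)^-1 C^j := ((l - A)^-1 C) C^(j-1), for j >= 1 *)
Definition cresolventX A C l (j : nat) : X -> X :=
  fun x => cresolvent A C l (iter j.-1 C x).

Lemma mresolventE A C l : rhoC A C l ->
  mresolvent A C l = mgraph (cresolvent A C l).
Proof.
move=> [_ [T [_ TE]]]; rewrite /cresolvent TE; apply/funext => x.
by rewrite /mgraph; case: xgetP => [y _ ->|/(_ (T x))] //; case.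
Qed.

End MultivaluedLinear.

(* Main.v *)
Require Import Defs.
From mathcomp Require Import all_boot all_order all_algebra.
From mathcomp Require Import complex.
From mathcomp Require Import all_classical all_reals all_analysis.
Import numFieldNormedType.Exports.
Local Open Scope classical_set_scope.
Local Open Scope ring_scope.

Import GRing.Theory.

(** Write [T l] for the [C]-resolvent at [l].  A pair [(u, w)] satisfies
    [u = T l w] exactly when [(u, l u - C w)] lies in the graph of the
    multivalued operator [A] ([cresolventP]), so every identity between
    resolvents can be proved by exhibiting a point of the linear graph of [A]
    and using that [T l] is single-valued.  In this way one gets
    - [C (T l x) = T l (C x)], from the invariance of the graph under [C]
      ([cresolvent_comm]);
    - the resolvent equation [T z (T l x) = (T l (C x) - T z (C x)) / (z - l)]
      ([resolvent_equation]), in which one extra [C] is the price for [C] not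
      being the identity.

    Part (i) ([cresolvent_iter]) follows by induction on [k]: the formula for
    [k], applied at [T l x], has a single term, namely [T z (C^k (T l x))], that
    still involves both resolvents; the resolvent equation replaces it by the
    [T z] term and the [i = 1] term of the formula for [k + 1].

    Part (ii) is part (i) in disguise: each application of [C] to a preimage
    under [l - A] is an application of [T l], so that [y \in (l - A)^k x]
    implies [C^k x = (T l)^k y] ([iter_mpow_shift]), and
    [T z (C^k x) = T z ((T l)^k y)]. *)

Section ResolventIdentities.
Context {K : numFieldType} {X : tvsType K}.
Variables (A : X -> set X) (mloA : is_mlo A) (C : {linear X -> X}).
Hypothesis CA : forall x y : X, A x y -> A (C x) (C y).
Implicit Types (l z c : K) (u v w x y : X).

Lemma mlo_graphZ c u v : A u v -> A (c *: u) (c *: v).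
Proof.
by move=> Auv; apply: (mlo_scale mloA); [exists v|exists v].
Qed.

Lemma mlo_graphB u v u' v' : A u v -> A u' v' -> A (u - u') (v - v').
Proof.
move=> Auv /(mlo_graphZ (-1)); rewrite !scaleN1r => Auv'.
apply: (mlo_add mloA); [by exists v|by exists (- v')|].
by exists v => //; exists (- v').
Qed.

(** Reduces all reasoning on resolvents to the graph of [A]: the direct
    implication is the defining inclusion, the converse is the
    single-valuedness contained in [rhoC]. *)
Lemma cresolventP l u w : rhoC A C l ->
  cresolvent A C l w = u <-> A u (l *: u - C w).
Proof.
move=> rl; have E : mresolvent A C l w u <-> cresolvent A C l w = u.
  by rewrite (mresolventE rl); split=> [->|<-].
rewrite -E; split.
  by move=> [y [_ ->]] [v Av <-]; rewrite subKr.
move=> Au; have CwP : mshift l A u (C w).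
  by exists (l *: u - C w) => //; rewrite subKr.
by exists (C w) => //; split=> //; exists u.
Qed.

Lemma cresolvent_graph l w : rhoC A C l ->
  A (cresolvent A C l w) (l *: cresolvent A C l w - C w).
Proof. by move=> rl; apply/(cresolventP _ _ _ rl). Qed.

(** The graph of [l - A] is invariant under [C] because that of [A] is. *)
Lemma graph_shift l x y : A x (l *: x - y) -> A (C x) (l *: C x - C y).
Proof. by move=> /CA; rewrite linearB linearZ. Qed.

Lemma cresolvent_comm l x : rhoC A C l ->
  cresolvent A C l (C x) = C (cresolvent A C l x).
Proof.
by move=> rl; apply/(cresolventP _ _ _ rl)/graph_shift/cresolvent_graph.
Qed.

Lemma iter_cresolvent_comm l k x : rhoC A C l ->
  iter k (cresolvent A C l) (C x) = C (iter k (cresolvent A C l) x).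
Proof. by move=> rl; elim: k => //= k ->; rewrite cresolvent_comm. Qed.

Lemma cresolvent_iterC l k x : rhoC A C l ->
  iter k C (cresolvent A C l x) = cresolvent A C l (iter k C x).
Proof. by move=> rl; elim: k => //= k ->; rewrite cresolvent_comm. Qed.

(** With [u] and [v] the resolvents of [C x] at [l] and [z], the graph of [A]
    contains [(u - v, l u - z v)]; since [u = C (T l x)], dividing by [z - l]
    gives the graph point that characterises [T z (T l x)]. *)
Lemma resolvent_equation l z x : rhoC A C l -> rhoC A C z -> z != l ->
  cresolvent A C z (cresolvent A C l x) =
    (z - l)^-1 *: (cresolvent A C l (C x) - cresolvent A C z (C x)).
Proof.
move=> rl rz zl; apply/(cresolventP _ _ _ rz); rewrite -cresolvent_comm //.
set u := cresolvent A C l (C x); set v := cresolvent A C z (C x).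
have zl0 : z - l != 0 by rewrite subr_eq0.
have -> : z *: ((z - l)^-1 *: (u - v)) - u =
    (z - l)^-1 *: ((l *: u - C (C x)) - (z *: v - C (C x))).
  rewrite -[X in _ - X](scalerK zl0) scalerA mulrC -scalerA -scalerBr.
  congr (_ *: _); rewrite scalerBr scalerBl !opprB.
  by rewrite addrC subrKA addrA subrK.
by apply/mlo_graphZ/mlo_graphB; apply: cresolvent_graph.
Qed.

Lemma cresolvent_iter x k l z : rhoC A C l -> rhoC A C z -> z != l ->
  cresolvent A C z (iter k (cresolvent A C l) x) =
    ((-1) ^+ k / (z - l) ^+ k) *: cresolventX A C z k.+1 x
    + \sum_(1 <= i < k.+1)
        ((-1) ^+ (k - i) / (z - l) ^+ (k + 1 - i)) *:
          iter i (cresolvent A C l) (iter (k + 1 - i) C x).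
Proof.
rewrite /cresolventX /= => rl rz zl; elim: k x => [|k IHk] x.
  by rewrite big_geq // addr0 !expr0 divr1 scale1r.
rewrite iterSr IHk cresolvent_iterC // resolvent_equation // -iterS.
(* The term [i = 1] of the new sum comes from the resolvent equation; the
   terms [i > 1] are those of the old sum, with index shifted by one. *)
rewrite [in RHS]big_nat_recl // [in RHS]addrA; congr (_ + _).
  rewrite subSS subn0 addn1 subSS subn0 /= scalerA scalerBr addrC.
  rewrite -mulrA -invfM -exprSr; congr (_ + _).
  by rewrite -scaleNr [(-1) ^+ k.+1]exprS mulN1r mulNr.
apply: eq_big_nat => i _.
by rewrite cresolvent_iterC // -iterSr addSn !subSS.
Qed.

(** One step: [y \in (l - A) w] says that [(w, l w - y)] is in the graph of
    [A]; applying [C] to it gives [C w = T l y]. *)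
Lemma iter_mpow_shift l k x y : rhoC A C l -> mpow (mshift l A) k x y ->
  iter k C x = iter k (cresolvent A C l) y.
Proof.
move=> rl; elim: k y => [|k IHk] y /=; first by move=> ->.
move=> [w [_ /IHk ->]] [v Awv <-].
rewrite -iter_cresolvent_comm // -iterS iterSr; congr (iter _ _ _).
by apply/esym/(cresolventP _ _ _ rl)/graph_shift; rewrite subKr.
Qed.

End ResolventIdentities.

Theorem theorem2p5 (R : realType) (X : tvsType R[i])
    (hausX : hausdorff_space X) (scX : sequentially_complete X)
    (A : X -> set X) (mloA : is_mlo A)
    (C : {linear X -> X}) (contC : continuous C)
    (CA : forall x y : X, A x y -> A (C x) (C y)) :
  (forall (x : X) (k : nat) (l z : R[i]),
     rhoC A C l -> rhoC A C z -> z != l ->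
     cresolvent A C z (iter k (cresolvent A C l) x) =
       ((-1) ^+ k / (z - l) ^+ k) *: cresolventX A C z k.+1 x
       + \sum_(1 <= i < k.+1)
           ((-1) ^+ (k - i) / (z - l) ^+ (k + 1 - i)) *:
             iter i (cresolvent A C l) (iter (k + 1 - i) C x))
  /\
  (forall (k : nat) (x y : X) (l0 z : R[i]),
     rhoC A C l0 -> rhoC A C z -> z != l0 ->
     mpow (mshift l0 A) k x y ->
     cresolventX A C z k.+1 x =
       ((-1) ^+ k / (z - l0) ^+ k) *: cresolventX A C z k.+1 y
       + \sum_(1 <= i < k.+1)
           ((-1) ^+ (k - i) / (z - l0) ^+ (k + 1 - i)) *:
             iter i (cresolvent A C l0) (iter (k + 1 - i) C y)).
Proof.
split=> [x k l z|k x y l0 z rl rz zl xy]; first exact: cresolvent_iter.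
by rewrite {1}/cresolventX /= (iter_mpow_shift _ _ CA _ _ _ _ rl xy) cresolvent_iter.
Qed.
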